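(* \begin{enumerate} \item If $1\le b<a$ are coprime integers such that $(a,b)\neq(2,1)$, then there are no $(a,b)$-triangular hitomezashi patterns. \item There are exactly $3$ distinct $(2,1)$-triangular hitomezashi patterns, and they differ only by translations. \end{enumerate}
   Context: The triangular grid has as its lattice points the points of the lattice generated by $(1,0)$ and $(1/2,\sqrt3/2)$; its grid lines are all lines through lattice points in one of the three directions $(1,0)$, $(1/2,\sqrt3/2)$, $(-1/2,\sqrt3/2)$. For positive integers $a,b$, an $(a,b)$-triangular hitomezashi pattern is a collection of line segments (stitches) lying along the grid lines such that: (i) on each grid line, in each of the three directions, the stitches follow an ''$a$-over-$b$-under'' pattern, i.e. they are segments of length $a$ with lattice-point endpoints, arranged periodically along the whole line with consecutive stitches separated by gaps of length $b$ (so the stitches on that line are the translates of one of them by all integer multiples of $a+b$ along the line); and (ii) the set of endpoints of stitches is the same for each of the three directions (i.e. every endpoint of a stitch is an endpoint of a stitch in each of the three directions). *)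

(* Defs.v *)
From HB Require Import structures.
From mathcomp Require Import all_boot all_order all_algebra.
From mathcomp Require Import all_classical all_reals.

Set Implicit Arguments.
Unset Strict Implicit.
Unset Printing Implicit Defensive.

Import Order.TTheory GRing.Theory Num.Theory.
Local Open Scope classical_set_scope.
Local Open Scope ring_scope.

Section TriangularHitomezashi.
Variable R : realType.

Definition plane := 'rV[R]_2.

Definition vec2 (x y : R) : plane := \row_(i < 2) [:: x; y]`_i.

(* The three grid directions are unit vectors; the first two generate the
   lattice. *)
Definition grid_dir (d : 'I_3) : plane :=
  [:: vec2 1 0;
      vec2 (1 / 2) (Num.sqrt 3 / 2);
      vec2 (- (1 / 2)) (Num.sqrt 3 / 2)]`_d.

Definition lattice_points : set plane :=
  [set x | exists i j : int,
     x = i%:~R *: vec2 1 0 + j%:~R *: vec2 (1 / 2) (Num.sqrt 3 / 2)].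

Definition line_through (p v : plane) : set plane :=
  [set p + t *: v | t in [set: R]].

Definition grid_lines (d : 'I_3) : set (set plane) :=
  [set line_through p (grid_dir d) | p in lattice_points].

Definition segment (p q : plane) : set plane :=
  [set (1 - t) *: p + t *: q | t in [set t : R | 0 <= t <= 1]].

(* A segment, as a set of points, determines its unordered pair of endpoints. *)
Definition segment_endpoints (s : set plane) : set plane :=
  [set p | exists q, s = segment p q].

Definition translate (v : plane) (s : set plane) : set plane :=
  [set x + v | x in s].

(* A collection of stitches [P] is a set of segments, each segment being the
   set of its points. *)
Definition stitches_on (P : set (set plane)) (l : set plane) :
  set (set plane) := [set s | P s /\ s `<=` l].

(* [S] is an a-over-b-under family along the line [l] of direction [d]: all
   the translates of one length-a segment by the multiples of a + b.  The far
   endpoint p + a *: grid_dir d is automatically a lattice point of [l]. *)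
Definition over_under (a b : nat) (d : 'I_3) (l : set plane)
    (S : set (set plane)) : Prop :=
  exists p : plane, [/\ lattice_points p, l p &
    S = [set translate ((k * (a + b)%:Z)%:~R *: grid_dir d)
                       (segment p (p + a%:R *: grid_dir d)) | k in [set: int]]].

Definition stitch_endpoints (P : set (set plane)) (d : 'I_3) : set plane :=
  [set x | exists l s, [/\ grid_lines d l, stitches_on P l s &
                           segment_endpoints s x]].

Definition triangular_hitomezashi (a b : nat) (P : set (set plane)) : Prop :=
  [/\ forall s, P s -> exists d l, grid_lines d l /\ s `<=` l,
      forall d l, grid_lines d l -> over_under a b d l (stitches_on P l)
    & forall d d', stitch_endpoints P d = stitch_endpoints P d'].

Definition translate_pattern (v : plane) (P : set (set plane)) :
  set (set plane) := [set translate v s | s in P].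

End TriangularHitomezashi.

(* Main.v *)
Require Import Defs.
From HB Require Import structures.
From mathcomp Require Import all_boot all_order all_algebra.
From mathcomp Require Import all_classical all_reals.
From mathcomp Require Import zify lra.

Set Implicit Arguments.
Unset Strict Implicit.
Unset Printing Implicit Defensive.

Import Order.TTheory GRing.Theory Num.Theory.
Local Open Scope classical_set_scope.
Local Open Scope ring_scope.

(** Lattice points are written in the basis of the first two grid directions,
so that the three directions become (1,0), (0,1) and (-1,1), and a pattern
gives the set E of integer points that are endpoints of stitches.  On each
grid line E consists of two residue classes c and c + a modulo n = a + b.
Since a is prime to n and n > 2, every point p of E has, for each direction D,
exactly one of its two relatives p + aD and p - aD in E.  Shrinking by a factor
a, one gets a nonempty set F of integer points in which each point has exactly
one neighbour along each of the three axes.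

This local rule alone determines F.  Starting from two vertically adjacent
points of F, following the forced neighbours reproduces vertically adjacent
points one step along (1,1) and along (1,-2) ([pair_steps]), hence at every
translate by the lattice of all (i,j) with j - i divisible by 3.  So F is the
complement of one class of j - i modulo 3 ([complement_of_class]): it is the
vertex set of a honeycomb.  Along a vertical line F therefore has period
exactly 3, whereas its period is n by construction, which forces n = 3 and
(a,b) = (2,1) ([long_stitch_lengths]).

When (a,b) = (2,1) the same rule holds for E itself, as 2 = -1 modulo 3.  So E
misses exactly one class m of j - i, and the stitches, which must join points
of E at distance 2, are the segments of length 2 centred at the points of that
class.  These do form a pattern, for each of the three values of m modulo 3, and
translations by (0,k) permute them. *)

(** * Sets with one neighbour along each axis *)

(** Coordinates of the grid directions in the basis of the first two. *)
Definition dx (d : 'I_3) : int := [:: 1; 0; -1]`_d.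
Definition dy (d : 'I_3) : int := [:: 0; 1; 1]`_d.

Definition one_neighbor_per_axis (F : int -> int -> Prop) :=
  forall d i j, F i j ->
    (F (i + dx d) (j + dy d) \/ F (i - dx d) (j - dy d)) /\
    ~ (F (i + dx d) (j + dy d) /\ F (i - dx d) (j - dy d)).

Lemma ord3_ind (Q : 'I_3 -> Prop) : Q 0 -> Q 1 -> Q 2 -> forall d, Q d.
Proof.
move=> Q0 Q1 Q2 [[|[|[|//]]] lt_d3].
- by rewrite (_ : Ordinal _ = 0) //; apply: val_inj.
- by rewrite (_ : Ordinal _ = 1) //; apply: val_inj.
- by rewrite (_ : Ordinal _ = 2) //; apply: val_inj.
Qed.

Lemma same_point (F : int -> int -> Prop) i j i' j' :
  i = i' -> j = j' -> F i j -> F i' j'.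
Proof. by move=> -> ->. Qed.

(** Transports a membership to a point whose coordinates agree with the known
ones up to integer arithmetic. *)
Ltac same_point := match goal with
  | H : ?F ?i ?j |- ?F ?i' ?j' =>
    by apply: (@same_point F i j i' j' _ _ H); rewrite ?/dx ?/dy /=; lia
  end.

Definition vertical_pair (F : int -> int -> Prop) i j := F i j /\ F i (j + 1).

Section LocalRule.
Variable F : int -> int -> Prop.
Hypothesis F_rule : one_neighbor_per_axis F.

Let row_nbr i j : F i j -> F (i + 1) j \/ F (i - 1) j.
Proof. by move=> /(F_rule 0) [[h|h] _]; [left|right]; same_point. Qed.
Let col_nbr i j : F i j -> F i (j + 1) \/ F i (j - 1).
Proof. by move=> /(F_rule 1) [[h|h] _]; [left|right]; same_point. Qed.
Let diag_nbr i j : F i j -> F (i - 1) (j + 1) \/ F (i + 1) (j - 1).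
Proof. by move=> /(F_rule 2) [[h|h] _]; [left|right]; same_point. Qed.
Let row_no3 i j : F (i - 1) j -> F i j -> F (i + 1) j -> False.
Proof. by move=> hm /(F_rule 0) [_ no] hp; apply: no; split; same_point. Qed.
Let col_no3 i j : F i (j - 1) -> F i j -> F i (j + 1) -> False.
Proof. by move=> hm /(F_rule 1) [_ no] hp; apply: no; split; same_point. Qed.
Let diag_no3 i j : F (i - 1) (j + 1) -> F i j -> F (i + 1) (j - 1) -> False.
Proof. by move=> hm /(F_rule 2) [_ no] hp; apply: no; split; same_point. Qed.

(** A unit square of F would leave its corner (i,j) without a diagonal
neighbour: either candidate lies three in a row or in a column with two
corners of the square. *)
Lemma no_block i j : vertical_pair F i j -> ~ vertical_pair F (i + 1) j.
Proof.
move=> [p q] [p' q']; case: (diag_nbr p) => h.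
  by apply: (@row_no3 i (j + 1)).
by apply: (@col_no3 (i + 1) j).
Qed.

(** If (i+1,j) were in F, the neighbours of (i,j+1) and then of (i-1,j+1)
would be forced, and give three consecutive points on the antidiagonal. *)
Lemma pair_not_right i j : vertical_pair F i j -> ~ F (i + 1) j.
Proof.
move=> pq r; have [p q] := pq.
have {}q' : F (i - 1) (j + 1).
  by case: (row_nbr q) => // r'; case: (no_block pq).
have s : F (i - 1) (j + 2).
  case: (col_nbr q') => s; first same_point.
  by exfalso; apply: (@row_no3 i j) => //; same_point.
by apply: (@diag_no3 i (j + 1)) => //; same_point.
Qed.

(** With the right-hand neighbour of the lower point excluded, every further
neighbour is forced; the four pairs surround the given one in the honeycomb. *)
Lemma pair_steps i j : vertical_pair F i j ->
  [/\ vertical_pair F (i + 1) (j + 1), vertical_pair F (i - 1) (j - 1),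
      vertical_pair F (i + 1) (j - 2) & vertical_pair F (i - 1) (j + 2)].
Proof.
move=> pq; have [p q] := pq; have nr := pair_not_right pq.
have l : F (i - 1) j by case: (row_nbr p).
have nl' : ~ F (i - 1) (j + 1).
  by move=> l'; apply: (@no_block (i - 1) j) => //; split; same_point.
have r' : F (i + 1) (j + 1) by case: (row_nbr q).
have ld : F (i - 1) (j - 1) by case: (col_nbr l).
have ru : F (i + 1) (j + 2).
  by case: (col_nbr r') => h; [same_point|case: nr; same_point].
have rd : F (i + 1) (j - 1) by case: (diag_nbr p).
have rdd : F (i + 1) (j - 2).
  by case: (col_nbr rd) => h; [case: nr|]; same_point.
have lu : F (i - 1) (j + 2).
  by case: (diag_nbr q) => h; [|case: nr]; same_point.
have luu : F (i - 1) (j + 3).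
  by case: (col_nbr lu) => h; [|case: nl']; same_point.
by split; split=> //; same_point.
Qed.

Lemma pair_translate i j k l :
  vertical_pair F i j -> vertical_pair F (i + k) (j + k + 3 * l).
Proof.
move=> pq; have {pq}pqk : vertical_pair F (i + k) (j + k).
  elim/int_ind: k => [|k IH|k IH]; first by rewrite !addr0.
    by have [h _ _ _] := pair_steps IH; same_point.
  by have [_ h _ _] := pair_steps IH; same_point.
elim/int_ind: l => [|l IH|l IH]; first by rewrite mulr0 addr0.
  have [h _ _ _] := pair_steps IH; have [_ _ _ h'] := pair_steps h.
  same_point.
have [_ h _ _] := pair_steps IH; have [_ _ h' _] := pair_steps h.
same_point.
Qed.

(** The pairs supply two of the three classes; a point of the third class
would lie directly below a pair, making three points in a column. *)
Lemma complement_of_class i0 j0 : F i0 j0 ->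
  exists c : int, forall i j, F i j <-> ~ (3 %| j - i - c)%Z.
Proof.
move=> F0; have [x [y xy]] : exists x y, vertical_pair F x y.
  case: (col_nbr F0) => h; first by exists i0, j0.
  by exists i0, (j0 - 1); split=> //; same_point.
have pairs i j : (3 %| (j - i) - (y - x))%Z -> vertical_pair F i j.
  move=> /dvdzP [l e]; have h := pair_translate (i - x) l xy; same_point.
exists (y - x - 1) => i j; split=> [Fij div|ndiv].
  have [h1 h2] : vertical_pair F i (j + 1) by apply: pairs; lia.
  by apply: (@col_no3 i (j + 1)) => //; same_point.
have [div|div] : (3 %| (j - i) - (y - x))%Z \/ (3 %| (j - 1 - i) - (y - x))%Z.
- lia.
- by have [] := pairs _ _ div.
- by have [_ h] := pairs _ _ div; same_point.
Qed.
End LocalRule.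

(** * Periodic sets with two residue classes on each line *)

Definition two_class_lines (a n : nat) (E : int -> int -> Prop) :=
  forall d i j, exists c : int, forall t : int,
    E (i + t * dx d) (j + t * dy d) <->
      (n %| t - c)%Z \/ (n %| t - c - a%:Z)%Z.

Section LongStitches.
Variables (a b : nat) (E : int -> int -> Prop).
Hypotheses (b_gt0 : (1 <= b)%N) (lt_ba : (b < a)%N) (co_ab : coprime a b).
Hypothesis lines : two_class_lines a (a + b) E.

Let ndvd_a : ~ ((a + b)%N %| a%:Z)%Z.
Proof. by rewrite dvdzE !absz_nat => /dvdn_leq; lia. Qed.

Let ndvd_2a : ~ ((a + b)%N %| 2 * a%:Z)%Z.
Proof.
rewrite dvdzE abszM !absz_nat Gauss_dvdl; first by move/dvdn_leq; lia.
by rewrite coprime_sym /coprime gcdnDl.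
Qed.

Let dvd_sub u v w :
  ((a + b)%N %| u)%Z -> ((a + b)%N %| v)%Z -> w = u - v -> ((a + b)%N %| w)%Z.
Proof. by move=> du dv ->; rewrite rpredB. Qed.

(** The classes c and c + a differ by a, while neither a nor 2a vanishes modulo
a + b; so a step of length a leads from one class to the other in exactly one
of the two senses.  The origin (i0,j0) is free because a point of E need not
have coordinates divisible by a. *)
Lemma rescaled_one_neighbor i0 j0 :
  one_neighbor_per_axis (fun i j => E (i0 + a%:Z * i) (j0 + a%:Z * j)).
Proof.
move=> d i j; have [c lineP] := lines d (i0 + a%:Z * i) (j0 + a%:Z * j).
have at_step k : E (i0 + a%:Z * (i + k * dx d)) (j0 + a%:Z * (j + k * dy d)) <->
    ((a + b)%N %| a%:Z * k - c)%Z \/ ((a + b)%N %| a%:Z * k - c - a%:Z)%Z.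
  by rewrite -lineP -!mulrA -!addrA -!mulrDr.
have /= := at_step 0; rewrite !(mul0r, mulr0, addr0, sub0r) => ->.
have /= := at_step 1; rewrite !(mul1r, mulr1) => ->.
have /= := at_step (-1); rewrite !(mulN1r, mulrN1) => ->.
move=> [h|h].
  split; first by left; right; rewrite (_ : _ - _ - _ = - c) //; lia.
  case=> _ [h'|h'].
    by apply: ndvd_a; apply: (dvd_sub h h'); lia.
  by apply: ndvd_2a; apply: (dvd_sub h h'); lia.
split; first by right; left; rewrite (_ : _ - _ = - c - a%:Z) //; lia.
case=> [[h'|h'] _].
  by apply: ndvd_2a; apply: (dvd_sub h' h); lia.
by apply: ndvd_a; apply: (dvd_sub h' h); lia.
Qed.

(** On a vertical line the rescaled set contains c + 1 and c + 4 but not c.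
Hence a(c+1) is in the first class of the line, and a(c+4), which is in one
of the two, differs from it by 3a; so a + b divides 3a or 2a. *)
Lemma long_stitch_lengths : (a, b) = (2%N, 1%N).
Proof.
have [c0 /(_ c0) line0] := lines 1 0 0.
set i0 := 0 + c0 * dx 1 in line0; set j0 := 0 + c0 * dy 1 in line0.
have E0 : E i0 j0 by apply/line0; left; rewrite subrr dvdz0.
have [|c FP] := @complement_of_class _ (@rescaled_one_neighbor i0 j0) 0 0.
  by rewrite mulr0 !addr0.
have {line0}[c' lineP] := lines 1 i0 j0.
have colP k : ~ (3 %| k - c)%Z <->
    ((a + b)%N %| a%:Z * k - c')%Z \/ ((a + b)%N %| a%:Z * k - c' - a%:Z)%Z.
  have := FP 0 k; rewrite subr0 => <-.
  by rewrite -lineP (_ : dx 1 = 0) // (_ : dy 1 = 1) // !mulr0 mulr1.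
have h1 : ((a + b)%N %| a%:Z * (c + 1) - c')%Z.
  have [h _] := colP (c + 1); case: h => // [|h]; first lia.
  have [_ []] := colP c; last by rewrite subrr dvdz0.
  by left; rewrite (_ : _ - _ = a%:Z * (c + 1) - c' - a%:Z) //; lia.
have h3 : ((a + b)%N %| a * 3)%N.
  have [h _] := colP (c + 4); case: h => [|h|h]; first lia.
    have : ((a + b)%N %| a%:Z * 3)%Z by apply: (dvd_sub h h1); lia.
    by rewrite dvdzE.
  by case: ndvd_2a; apply: (dvd_sub h h1); lia.
move: h3; rewrite Gauss_dvdr; last by rewrite coprime_sym /coprime gcdnDl.
move=> /dvdn_leq le_n3; have {}le_n3 : (a + b <= 3)%N by apply: le_n3.
by congr (_, _); lia.
Qed.

End LongStitches.

(** Modulo 3 the classes c and c + 2 are consecutive, so steps of length 1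
already satisfy the local rule and no rescaling is needed. *)
Lemma two_class_lines_complement E : two_class_lines 2 3 E ->
  exists c : int, forall i j, E i j <-> ~ (3 %| j - i - c)%Z.
Proof.
move=> lines; have [c lineP] := lines 0 0 0.
apply: (@complement_of_class E _ (0 + c * dx 0) (0 + c * dy 0)); last first.
  by apply/lineP; left; rewrite subrr dvdz0.
move=> d i j; have {c lineP}[c lineP] := lines d i j.
have := lineP 0; rewrite !mul0r !addr0 => ->.
have := lineP 1; rewrite !mul1r => ->.
have := lineP (-1); rewrite !mulN1r => ->.
by lia.
Qed.

(** * Segments and lines *)

Section Segments.
Variable R : realType.
Implicit Types p q v x : plane R.

Lemma segment_sym p q : segment p q = segment q p.
Proof.
suff sub u v : segment u v `<=` segment v u by rewrite eqEsubset.
move=> _ [t t01 <-]; exists (1 - t); first by move: t01 => /=; lra.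
by rewrite subKr addrC.
Qed.

Lemma segment_left p q : segment p q p.
Proof. by exists 0; rewrite /= ?lexx ?ler01 // subr0 scale1r scale0r addr0. Qed.

(** Endpoints are the extreme points: p' is the origin of the ray towards q',
and a convex combination of two points of that ray is the origin only if it is
one of the two points. *)
Lemma segment_extreme p q p' q' :
  segment p' q' p -> segment p' q' q -> segment p q p' -> p' = p \/ p' = q.
Proof.
move=> [t t01 <-] [u u01 <-] [s s01].
have [->|neq] := eqVneq p' q'.
  by move=> _; left; rewrite -scalerDl subrK scale1r.
(* w is the parameter of p' on the segment from p' to q' *)
set w := (1 - s) * t + s * u => e.
have w0 : w = 0.
  have : w *: (q' - p') = 0.
    apply/rowP => k; have := congr1 (fun z : plane R => z 0 k) e.
    by rewrite /w !mxE; lra.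
  by move/eqP; rewrite scaler_eq0 subr_eq0 [q' == _]eq_sym (negPf neq) orbF => /eqP.
have /eqP : (1 - s) * t = 0 by move: t01 u01 s01 w0 => /=; rewrite /w; nra.
rewrite mulf_eq0 => /orP[/eqP s1|/eqP ->]; last first.
  by left; rewrite subr0 scale1r scale0r addr0.
have u0 : u = 0 by move: w0; rewrite /w s1 mul0r add0r; nra.
by right; rewrite u0 subr0 scale1r scale0r addr0.
Qed.

Lemma segment_endpointsE p q x :
  segment_endpoints (segment p q) x <-> x = p \/ x = q.
Proof.
split=> [[y e]|[->|->]]; last 2 first.
- by exists q.
- by exists p; rewrite segment_sym.
apply: (@segment_extreme p q x y).
- by rewrite -e; exact: segment_left.
- by rewrite -e segment_sym; exact: segment_left.
- by rewrite e; exact: segment_left.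
Qed.

Lemma translate_segment v p q :
  translate v (segment p q) = segment (p + v) (q + v).
Proof.
have comb t : (1 - t) *: (p + v) + t *: (q + v) = (1 - t) *: p + t *: q + v.
  by rewrite !scalerDr addrACA -[X in _ + X]scalerDl subrK scale1r.
rewrite eqEsubset; split=> [_ [_ [t t01 <-] <-]|_ [t t01 <-]].
  by exists t.
by exists ((1 - t) *: p + t *: q); [exists t | rewrite comb].
Qed.

Lemma line_through_eq p v x :
  line_through p v x -> line_through p v = line_through x v.
Proof.
move=> [t _ <-]; rewrite eqEsubset; split=> _ [s _ <-].
  by exists (s - t) => //; rewrite -addrA -scalerDl subrKC.
by exists (t + s) => //; rewrite scalerDl addrA.
Qed.

End Segments.

(** * Lattice points, grid lines and stitches in integer coordinates *)

Section Lattice.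
Variable R : realType.

Definition lat (i j : int) : plane R :=
  i%:~R *: vec2 1 0 + j%:~R *: vec2 (1 / 2) (Num.sqrt 3 / 2).

Lemma lat_coord0 i j : lat i j 0 0 = i%:~R + j%:~R / 2.
Proof. by rewrite !mxE /=; lra. Qed.

Lemma lat_coord1 i j : lat i j 0 1 = j%:~R * (Num.sqrt 3 / 2).
Proof. by rewrite !mxE /=; lra. Qed.

Lemma lat_add i j k l : lat (i + k) (j + l) = lat i j + lat k l.
Proof. by rewrite /lat !intrD !scalerDl addrACA. Qed.

Lemma grid_dir_lat d : grid_dir R d = lat (dx d) (dy d).
Proof.
elim/ord3_ind: d; rewrite /grid_dir /lat /dx /dy /=.
- by rewrite scale1r scale0r addr0.
- by rewrite scale1r scale0r add0r.
rewrite scale1r scaleN1r; apply/rowP => k; rewrite !mxE.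
by case: k => [[|[|//]] ?] /=; lra.
Qed.

Lemma lat_shift t i j d :
  lat (i + t * dx d) (j + t * dy d) = lat i j + t%:~R *: grid_dir R d.
Proof. by rewrite lat_add grid_dir_lat /lat !intrM scalerDr !scalerA. Qed.

(** The two coordinates of each direction include a unit, so the real parameter
s is an integer. *)
Lemma lat_on_line i j i0 j0 d (s : R) : lat i0 j0 + s *: grid_dir R d = lat i j ->
  exists2 t : int, s = t%:~R & i = i0 + t * dx d /\ j = j0 + t * dy d.
Proof.
rewrite grid_dir_lat => e.
have linE (u v : plane R) k : (u + s *: v) 0 k = u 0 k + s * v 0 k by rewrite !mxE.
have nz : Num.sqrt 3 / 2 != 0 :> R.
  by apply: lt0r_neq0; rewrite divr_gt0 ?sqrtr_gt0 ?ltr0n.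
have ej : (j - j0)%:~R = s * (dy d)%:~R.
  have := congr1 (fun z : plane R => z 0 1) e.
  rewrite linE !lat_coord1 (mulrA s) -mulrDl => /(mulIf nz) e1.
  by rewrite intrD intrN -e1 addrC addKr.
have ei : (i - i0)%:~R = s * (dx d)%:~R.
  have := congr1 (fun z : plane R => z 0 0) e.
  rewrite linE !lat_coord0.
  by move: ej; rewrite !intrD !intrN; lra.
move: d ei ej {e}; apply: ord3_ind; rewrite /dx /dy /=.
- rewrite mulr1 mulr0 => <- ej; exists (i - i0) => //.
  by have : j - j0 = 0; [apply/eqP; rewrite -(intr_eq0 R) ej|lia].
- rewrite mulr1 mulr0 => ei <-; exists (j - j0) => //.
  by have : i - i0 = 0; [apply/eqP; rewrite -(intr_eq0 R) ei|lia].
rewrite mulrN1 mulr1 => + es; rewrite -es -intrN => /intr_inj ?.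
by exists (j - j0); [|lia].
Qed.

Lemma lat_inj i j k l : lat i j = lat k l -> i = k /\ j = l.
Proof.
move=> e; have : lat k l + 0 *: grid_dir R 0 = lat i j by rewrite scale0r addr0.
by case/lat_on_line => t /esym/eqP; rewrite intr_eq0 => /eqP -> [-> ->]; lia.
Qed.

Definition lat_line d i j := line_through (lat i j) (grid_dir R d).

Lemma grid_lineP d l : grid_lines d l <-> exists i j, l = lat_line d i j.
Proof.
split=> [[_ [i [j ->]] <-]|[i [j ->]]]; first by exists i, j.
by exists (lat i j) => //; exists i, j.
Qed.

Lemma lat_lineP d i0 j0 i j : lat_line d i0 j0 (lat i j) <->
  exists t, i = i0 + t * dx d /\ j = j0 + t * dy d.
Proof.
split=> [[s _ /lat_on_line [t _ ?]]|[t [-> ->]]]; first by exists t.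
by exists t%:~R => //; rewrite lat_shift.
Qed.

Definition stitch (a : nat) d i j : set (plane R) :=
  segment (lat i j) (lat (i + a%:Z * dx d) (j + a%:Z * dy d)).

Lemma stitch_endpointP a d i j x : segment_endpoints (stitch a d i j) x <->
  x = lat i j \/ x = lat (i + a%:Z * dx d) (j + a%:Z * dy d).
Proof. exact: segment_endpointsE. Qed.

Lemma stitch_sub_line a d i j : stitch a d i j `<=` lat_line d i j.
Proof.
move=> _ [t _ <-]; exists (t * a%:R) => //.
rewrite lat_shift (scalerDr t) addrA -scalerDl subrK scale1r scalerA.
by rewrite -pmulrn.
Qed.

(** Both ends of the stitch lie on the line, and their difference is a nonzero
multiple of only one direction. *)
Lemma stitch_on_line a d i j d' i0 j0 : (0 < a)%N ->
  stitch a d i j `<=` lat_line d' i0 j0 ->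
  d = d' /\ exists t, i = i0 + t * dx d /\ j = j0 + t * dy d.
Proof.
move=> a_gt0 sub.
have /sub /lat_lineP [t [ei ej]] : stitch a d i j (lat i j).
  exact: segment_left.
have /sub /lat_lineP [u [fi fj]] :
    stitch a d i j (lat (i + a%:Z * dx d) (j + a%:Z * dy d)).
  by rewrite /stitch segment_sym; apply: segment_left.
have edd' : d = d'.
  elim/ord3_ind: d fi fj {sub}; elim/ord3_ind: d' ei ej => //;
    rewrite /dx /dy /=; nia.
by split=> //; exists t; rewrite edd'.
Qed.

Lemma translate_stitch a d i j k l :
  translate (lat k l) (stitch a d i j) = stitch a d (i + k) (j + l).
Proof.
by rewrite translate_segment -!lat_add /stitch !(addrAC _ (_ * _)).
Qed.

Definition line_stitches a d i0 j0 (T : set int) : set (set (plane R)) :=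
  [set stitch a d (i0 + t * dx d) (j0 + t * dy d) | t in T].

Lemma over_underP a b d i0 j0 S :
  over_under a b d (lat_line d i0 j0) S <->
  exists c : int, S = line_stitches a d i0 j0 [set t | ((a + b)%N %| t - c)%Z].
Proof.
have family c :
    [set translate ((k * (a + b)%:Z)%:~R *: grid_dir R d)
       (stitch a d (i0 + c * dx d) (j0 + c * dy d)) | k in [set: int]] =
    line_stitches a d i0 j0 [set t | ((a + b)%N %| t - c)%Z].
  have step k : translate ((k * (a + b)%:Z)%:~R *: grid_dir R d)
      (stitch a d (i0 + c * dx d) (j0 + c * dy d)) =
      stitch a d (i0 + (c + k * (a + b)%N%:Z) * dx d)
                 (j0 + (c + k * (a + b)%N%:Z) * dy d).
    have := lat_shift (k * (a + b)%:Z) 0 0 d; rewrite !add0r.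
    rewrite [lat 0 0]/lat !scale0r !add0r => <-; rewrite translate_stitch.
    by rewrite !mulrDl !addrA.
  rewrite eqEsubset; split=> [_ [k _ <-]|_ [t /dvdzP [k e] <-]].
    exists (c + k * (a + b)%N%:Z) => //=.
    by rewrite addrAC subrr add0r dvdz_mull.
  by exists k => //; rewrite step -e subrKC.
split=> [[_ [[i [j ->]] /lat_lineP [c [-> ->]] ->]]|[c ->]].
  by exists c; rewrite -family /stitch (lat_shift a).
exists (lat (i0 + c * dx d) (j0 + c * dy d)); split.
- by exists (i0 + c * dx d), (j0 + c * dy d).
- by apply/lat_lineP; exists c.
- by rewrite -family /stitch (lat_shift a).
Qed.

End Lattice.

(** * Patterns and their endpoints *)

Section Patterns.
Variable R : realType.
Implicit Types P Q : set (set (plane R)).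

(** Direction 0 is an arbitrary choice: in a hitomezashi pattern the three sets
of endpoints coincide. *)
Definition endpoint_at P (i j : int) : Prop := stitch_endpoints P 0 (lat R i j).

(** An endpoint at a point of the line is always produced by a stitch on that
very line, because two grid lines of one direction that meet are equal. *)
Lemma hitomezashi_line a b P d i j : (0 < a)%N ->
  triangular_hitomezashi a b P ->
  exists c : int,
    stitches_on P (lat_line d i j) =
      line_stitches a d i j [set t | ((a + b)%N %| t - c)%Z] /\
    forall t, endpoint_at P (i + t * dx d) (j + t * dy d) <->
      ((a + b)%N %| t - c)%Z \/ ((a + b)%N %| t - c - a%:Z)%Z.
Proof.
move=> a_gt0 [_ lineP sameE].
have gl : grid_lines d (@lat_line R d i j) by apply/grid_lineP; exists i, j.
have /over_underP [c onl] := lineP _ _ gl; exists c; split=> // t.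
have step_inj u v : lat R (i + u * dx d) (j + u * dy d) =
    lat R (i + v * dx d) (j + v * dy d) -> u = v.
  move=> /lat_inj []; elim/ord3_ind: d {gl onl}; rewrite /dx /dy /=; lia.
have step_add u : lat R (i + u * dx d + a%:Z * dx d) (j + u * dy d + a%:Z * dy d) =
    lat R (i + (u + a%:Z) * dx d) (j + (u + a%:Z) * dy d).
  by rewrite !mulrDl !addrA.
rewrite /endpoint_at (sameE 0 d); split.
  move=> [l [s [/grid_lineP [i' [j' ->]] [Ps sub] sx]]].
  have {sub}sub : s `<=` lat_line d i j.
    have xl' : lat_line d i' j' (lat R (i + t * dx d) (j + t * dy d)).
      by apply: sub; case: sx => q ->; exact: segment_left.
    rewrite /lat_line (line_through_eq (x := lat R (i + t * dx d) (j + t * dy d))).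
      by rewrite -(line_through_eq xl').
    by apply/lat_lineP; exists t.
  have : stitches_on P (lat_line d i j) s by [].
  rewrite onl => -[u /= du es]; move: sx; rewrite -es => /stitch_endpointP.
  rewrite step_add => -[/step_inj ->|/step_inj ->]; [by left|right].
  by rewrite (_ : _ - a%:Z = u - c) //; lia.
have reach u : ((a + b)%N %| u - c)%Z -> t = u \/ t = u + a%:Z ->
    stitch_endpoints P d (lat R (i + t * dx d) (j + t * dy d)).
  move=> du tu; exists (lat_line d i j), (stitch a d (i + u * dx d) (j + u * dy d)).
  split=> //; first by rewrite onl; exists u.
  by apply/stitch_endpointP; rewrite step_add; case: tu => ->; [left|right].
case=> h; first by apply: (reach t) => //; left.
by apply: (reach (t - a%:Z)); [rewrite addrAC|right; rewrite subrK].
Qed.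

Lemma hitomezashi_two_class_lines a b P : (0 < a)%N ->
  triangular_hitomezashi a b P -> two_class_lines a (a + b) (endpoint_at P).
Proof.
move=> a_gt0 hP d i j.
by have [c [_ ?]] := hitomezashi_line d i j a_gt0 hP; exists c.
Qed.

(** Stitches of length 2 centred at the points with j - i = m modulo 3. *)
Definition class_pattern (m : int) : set (set (plane R)) :=
  [set s | exists d i j,
     (3 %| (j + dy d) - (i + dx d) - m)%Z /\ s = stitch 2 d i j].

Lemma class_pattern_on_line m d i0 j0 :
  stitches_on (class_pattern m) (lat_line d i0 j0) =
  line_stitches 2 d i0 j0
    [set t | (3 %| (j0 + (t + 1) * dy d) - (i0 + (t + 1) * dx d) - m)%Z].
Proof.
rewrite eqEsubset; split=> [s [[d' [i [j [mid ->]]]] sub]|_ [t /= mid <-]].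
  have [edd' [t [ei ej]]] := stitch_on_line (isT : (0 < 2)%N) sub.
  subst d'; exists t; last by rewrite ei ej.
  by move: mid; rewrite ei ej /= !mulrDl !mul1r !addrA.
split.
  exists d, (i0 + t * dx d), (j0 + t * dy d); split=> //.
  by move: mid; rewrite !mulrDl !mul1r !addrA.
rewrite /lat_line (line_through_eq (x := lat R (i0 + t * dx d) (j0 + t * dy d))).
  exact: stitch_sub_line.
by apply/lat_lineP; exists t.
Qed.

(** A unit step in any direction changes j - i by 1 or -1 modulo 3.  So the
ends of a stitch avoid the class of its centre, and from a point outside the
class exactly one of the two unit steps in direction d reaches a centre. *)
Lemma class_pattern_endpoints m d x :
  stitch_endpoints (class_pattern m) d x <->
  exists i j, ~ (3 %| j - i - m)%Z /\ x = lat R i j.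
Proof.
have on_own_line i j : (3 %| (j + dy d) - (i + dx d) - m)%Z ->
    stitches_on (class_pattern m) (lat_line d i j) (stitch 2 d i j).
  by move=> h; split; [exists d, i, j|exact: stitch_sub_line].
have own_line i j : grid_lines d (@lat_line R d i j).
  by apply/grid_lineP; exists i, j.
split=> [[l [s [/grid_lineP [i0 [j0 ->]]]]]|[i [j [nm ->]]]].
  rewrite class_pattern_on_line => -[t /= mid <-] /stitch_endpointP [] ->.
    exists (i0 + t * dx d), (j0 + t * dy d); split=> //.
    elim/ord3_ind: d mid {on_own_line own_line}; rewrite /dx /dy /=; lia.
  eexists _, _; split; last reflexivity.
  elim/ord3_ind: d mid {on_own_line own_line}; rewrite /dx /dy /=; lia.
have [h|h] : (3 %| (j + dy d) - (i + dx d) - m)%Z \/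
             (3 %| (j - 2 * dy d + dy d) - (i - 2 * dx d + dx d) - m)%Z.
- elim/ord3_ind: d nm {on_own_line own_line}; rewrite /dx /dy /=; lia.
- exists (lat_line d i j), (stitch 2 d i j).
  by split; [exact: own_line|exact: on_own_line|apply/stitch_endpointP; left].
set i' := i - 2 * dx d in h *; set j' := j - 2 * dy d in h *.
exists (lat_line d i' j'), (stitch 2 d i' j').
split; [exact: own_line|exact: on_own_line|apply/stitch_endpointP; right].
by rewrite /i' /j' !subrK.
Qed.

Lemma class_pattern_hitomezashi m : triangular_hitomezashi 2 1 (class_pattern m).
Proof.
split=> [_ [d [i [j [_ ->]]]]|d l /grid_lineP [i [j ->]]|d d'].
- exists d, (lat_line d i j); split; last exact: stitch_sub_line.
  by apply/grid_lineP; exists i, j.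
- apply/over_underP; rewrite class_pattern_on_line.
  have [c cP] : exists c : int, forall t : int,
      (3 %| (j + (t + 1) * dy d) - (i + (t + 1) * dx d) - m)%Z <-> (3 %| t - c)%Z.
    move: d; apply: ord3_ind; rewrite /dx /dy /=.
    - by exists (j - i - 1 - m) => t; lia.
    - by exists (m + i - j - 1) => t; lia.
    - by exists (j - i + 2 - m) => t; lia.
  by exists c; congr line_stitches; apply/funext => t; apply/propext/cP.
by apply/funext => x; apply/propext; rewrite !class_pattern_endpoints.
Qed.

(** The ends of a stitch avoid the missing class, which forces its centre into
that class.  Conversely, on the line through a segment centred in the class,
the missing point determines the phase of the stitches. *)
Lemma hitomezashi_class_pattern P : triangular_hitomezashi 2 1 P ->
  exists m, P = class_pattern m.
Proof.
move=> hP; have [m EP] :=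
  two_class_lines_complement (hitomezashi_two_class_lines (a := 2) isT hP).
exists m; rewrite eqEsubset; split=> s.
  move=> Ps; have [covered _ _] := hP.
  have [d [_ [/grid_lineP [i [j ->]] sub]]] := covered _ Ps.
  have [c [onl ptP]] := hitomezashi_line (a := 2) d i j isT hP.
  have : stitches_on P (lat_line d i j) s by [].
  rewrite onl => -[t /= dt <-].
  exists d, (i + t * dx d), (j + t * dy d); split=> //.
  have : endpoint_at P (i + t * dx d) (j + t * dy d) by apply/ptP; left.
  have : endpoint_at P (i + (t + 2) * dx d) (j + (t + 2) * dy d).
    by apply/ptP; right; rewrite (_ : _ - 2%:Z = t - c) //; lia.
  rewrite !EP; elim/ord3_ind: d {sub onl ptP}; rewrite /dx /dy /=; lia.
move=> [d [i [j [mid ->]]]].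
have [c [onl ptP]] := hitomezashi_line (a := 2) d i j isT hP.
suff dc : (3 %| 0 - c)%Z.
  suff [] : stitches_on P (lat_line d i j) (stitch 2 d i j) by [].
  by rewrite onl; exists 0 => //; rewrite !mul0r !addr0.
have [E0 E1] : endpoint_at P (i + 0 * dx d) (j + 0 * dy d) /\
               ~ endpoint_at P (i + 1 * dx d) (j + 1 * dy d).
  rewrite !EP; elim/ord3_ind: d mid {onl ptP}; rewrite /dx /dy /=; lia.
by move: E0 E1; rewrite !ptP; lia.
Qed.

Lemma class_pattern_eq m m' :
  class_pattern m = class_pattern m' <-> (3 %| m - m')%Z.
Proof.
split=> [e|dmm'].
  have /iff_not2 [h _] : stitch_endpoints (class_pattern m) 0 (lat R 0 m) <->
      stitch_endpoints (class_pattern m') 0 (lat R 0 m) by rewrite e.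
  apply: contrapT => nd; apply: h.
    by move/class_pattern_endpoints => [i [j [nm /lat_inj [ei ej]]]]; lia.
  by apply/class_pattern_endpoints; exists 0, m; split=> //; lia.
by apply/funext => s; apply/propext; split=> -[d [i [j [h ->]]]];
  exists d, i, j; split=> //; lia.
Qed.

Lemma translate_class_pattern m k :
  translate_pattern (lat R 0 k) (class_pattern m) = class_pattern (m + k).
Proof.
rewrite eqEsubset; split=> [_ [_ [d [i [j [h ->]]]] <-]|_ [d [i [j [h ->]]]]].
  exists d, (i + 0), (j + k); split; first lia.
  exact: translate_stitch.
exists (stitch 2 d i (j - k)).
  by exists d, i, (j - k); split=> //; lia.
by rewrite translate_stitch addr0 subrK.
Qed.

End Patterns.

Theorem theorem4p3 (R : realType) :
  (forall a b : nat, (1 <= b)%N -> (b < a)%N -> coprime a b ->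
     (a, b) <> (2%N, 1%N) ->
     ~ exists P : set (set (plane R)), triangular_hitomezashi a b P) /\
  (([set P : set (set (plane R)) | triangular_hitomezashi 2 1 P] #= `I_3)%card /\
   (forall P Q : set (set (plane R)),
      triangular_hitomezashi 2 1 P -> triangular_hitomezashi 2 1 Q ->
      exists v : plane R, Q = translate_pattern v P)).
Proof.
split=> [a b b_gt0 lt_ba co_ab neq [P hP]|].
  apply/neq/(long_stitch_lengths b_gt0 lt_ba co_ab).
  by apply: hitomezashi_two_class_lines hP; apply: leq_trans lt_ba.
split=> [|_ _ /hitomezashi_class_pattern [m ->] /hitomezashi_class_pattern [m' ->]].
  have -> : [set P : set (set (plane R)) | triangular_hitomezashi 2 1 P] =
      [set class_pattern k%:Z | k in `I_3].
    apply/seteqP; split=> [P /hitomezashi_class_pattern [m ->]|_ [k _ <-]].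
      exists `|(m %% 3)%Z|%N; first by rewrite /=; lia.
      by apply/class_pattern_eq; lia.
    exact: class_pattern_hitomezashi.
  apply: inj_card_eq => k l; rewrite !inE /= => k3 l3 /class_pattern_eq; lia.
by exists (lat R 0 (m' - m)); rewrite translate_class_pattern subrKC.
Qed.
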